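(* Let $A$ be a continuous dcpo, and for $x\in A$ let $I_x=\{y\in A\mid\{x,y\}\text{ has no upper bound in }A\}$ and $J_x=\{y\in A\mid x\in\mathrm{Int}(I_y)\}$. If $f:A\to\mathcal P(A)$ is a Scott continuous function and $f(x)\subseteq I_x$ for all $x\in A$, then $f(x)\subseteq J_x$ for all $x\in A$.
   Context: Directed sets are nonempty. A dcpo is a poset with least element in which every directed subset has a least upper bound. $x\ll y$ means: for every directed $S$ with $y\sqsubseteq\sqcup S$ there is $s\in S$ with $x\sqsubseteq s$. A dcpo $A$ is continuous (with basis $K\subseteq A$) if for every $a\in A$ the set $\{k\in K\mid k\ll a\}$ is directed with supremum $a$. $U\subseteq A$ is Scott open if it is upward closed and meets every directed $S$ with $\sqcup S\in U$; $\mathrm{Int}$ is interior in the Scott topology. $\mathcal P(A)$ is the powerset of $A$ ordered by inclusion. Scott continuous means monotone and preserving directed suprema. *)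

(* Defs.v *)
From HB Require Import structures.
From mathcomp Require Import all_boot all_order.
From mathcomp Require Export boolp classical_sets topology_structure.

Set Implicit Arguments.
Unset Strict Implicit.
Unset Printing Implicit Defensive.

Local Open Scope classical_set_scope.
Local Open Scope order_scope.

Definition directed d (A : porderType d) (S : set A) : Prop :=
  S !=set0 /\
  forall x y, S x -> S y -> exists z, [/\ S z, x <= z & y <= z].

(* The least element of a dcpo is provided by bPOrderType. *)
Definition dcpo d (A : bPOrderType d) : Prop :=
  forall S : set A, directed S -> exists s, isLub S s.

Definition way_below d (A : porderType d) (x y : A) : Prop :=
  forall (S : set A) (m : A), directed S -> isLub S m -> y <= m ->
    exists2 s, S s & x <= s.

Definition dcpo_basis d (A : porderType d) (K : set A) : Prop :=
  forall a : A, let B := [set k | K k /\ way_below k a] in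
    directed B /\ isLub B a.

Definition continuous_dcpo d (A : bPOrderType d) : Prop :=
  dcpo A /\ exists K : set A, dcpo_basis K.

Definition scott_open d (A : porderType d) (U : set A) : Prop :=
  (forall x y : A, x <= y -> U x -> U y) /\
  (forall (S : set A) (m : A), directed S -> isLub S m -> U m ->
    S `&` U !=set0).

(* Alias of A carrying the Scott topology. *)
Definition scott d (A : porderType d) : Type := A.

Section ScottTopology.
Context d (A : porderType d).

HB.instance Definition _ := Choice.on (scott A).

Lemma scott_openT : scott_open (setT : set A).
Proof.
split=> // S m [[x Sx] _] _ _; by exists x.
Qed.

Lemma scott_openI : setI_closed (@scott_open d A).
Proof.
move=> U V [upU inU] [upV inV]; split=> [x y lexy [Ux Vx]|S m dS Sm [Um Vm]].
  by split; [apply: upU Ux|apply: upV Vx].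
have [x [Sx Ux]] := inU S m dS Sm Um.
have [y [Sy Vy]] := inV S m dS Sm Vm.
have [z [Sz xz yz]] := dS.2 x y Sx Sy.
by exists z; split=> //; split; [apply: upU Ux|apply: upV Vy].
Qed.

Lemma scott_open_bigcup (I : Type) (U : I -> set A) :
  (forall i, scott_open (U i)) -> scott_open (\bigcup_i U i).
Proof.
move=> oU; split=> [x y lexy [i _ Ux]|S m dS Sm [i _ Um]].
  by exists i => //; apply: (oU i).1 lexy Ux.
have [x [Sx Ux]] := (oU i).2 S m dS Sm Um.
by exists x; split=> //; exists i.
Qed.

HB.instance Definition _ := @isOpenTopological.Build (scott A)
  (@scott_open d A) scott_openT scott_openI scott_open_bigcup.

End ScottTopology.

Lemma scott_openE d (A : porderType d) :
  (@open (scott A) : set (set A)) = @scott_open d A.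
Proof. by []. Qed.

Definition scott_continuous d d' (A : porderType d) (B : porderType d')
    (f : A -> B) : Prop :=
  {homo f : x y / x <= y} /\
  forall (S : set A) (m : A), directed S -> isLub S m -> isLub (f @` S) (f m).

Definition incompatible d (A : porderType d) (x : A) : set A :=
  [set y | ~ has_ubound [set x; y]].

Definition apart d (A : porderType d) (x : A) : set A :=
  [set y | (incompatible y : set (scott A))° x].

(* Main.v *)
(* For a fixed y, Scott continuity of f makes {z | y \in f z} Scott open, and by
   symmetry of incompatibility it is contained in I_y; hence it witnesses
   x \in Int I_y as soon as y \in f x. *)
Require Import Defs.
From mathcomp Require Import all_boot all_order.

Local Open Scope classical_set_scope.

(* The order on set A (powerset of A) used by scott_continuous f is inclusion. *)
Theorem theorem12p4p1 (d : Order.disp_t) (A : bPOrderType d)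
    (hA : continuous_dcpo A) (f : A -> set A) (hf : scott_continuous f)
    (hI : forall x : A, f x `<=` incompatible x) :
  forall x : A, f x `<=` apart x.
Proof.
move=> x y fxy.
have [fmono fsup] := hf.
have openU : @open (scott A) [set z | f z y].
  split=> [u v /fmono|S m dS Sm fmy]; first by rewrite subsetEset; apply.
  (* The union of the [f s] for [s] in [S] bounds the image of [S] from above, so it contains the
     least upper bound [f m]. Hence [y], being in [f m], already lies in some [f s]. *)
  have [_ least] := fsup S m dS Sm.
  have /least : ubound (f @` S) (\bigcup_(s in S) f s).
    by move=> _ [s Ss <-]; rewrite subsetEset => z fsz; exists s.
  by rewrite subsetEset => /(_ y fmy) [s Ss fsy]; exists s.
(* This open set contains [x] by [fxy]. It lies in [incompatible y]: if [y] is in [f z], then [hI]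
   says that [[set z; y]] is unbounded, and this pair is unordered. *)
exists [set z | f z y] => //; split=> // z /hI; rewrite /incompatible /=.
by rewrite classical_sets.setUC.
Qed.
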